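(* Let $Q_1$ and $Q_2$ be quantum CSS codes of lengths $n_1$ and $n_2$, with $n_2<n_1$, each encoding a single logical qubit, such that $Q_1$ has a local geometry of $Q_2$ in its first $n_2$ positions. Then: (1) The operator $$\overline{\mathrm{CNOT}}=\bigotimes_{i=1}^{n_2}\mathrm{CNOT}_i,$$ where $\mathrm{CNOT}_i$ has its control on the $i$-th qubit of $Q_1$ and its target on the $i$-th qubit of $Q_2$, is a (transversal) logical CNOT gate between $Q_1$ and $Q_2$, with control the logical qubit of $Q_1$ and target the logical qubit of $Q_2$. (2) If $Q_1$ realizes the logical $R_Z(\theta)$ gate through the physical operation $O$, then the following circuit outputs the logical state $|R_Z(\theta)\rangle$ on $Q_2$: prepare the logical state $|+\rangle$ in $Q_1$ and the logical state $|0\rangle$ in $Q_2$; apply $O$ to $Q_1$; apply $\overline{\mathrm{CNOT}}$; measure the logical $X$-operator $X_L$ of $Q_1$; if the measurement outcome is $-1$, apply the logical $Z$-operator $Z_L$ of $Q_2$ to $Q_2$ (and do nothing if the outcome is $+1$).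
   Context: CSS codes: for binary linear codes $C_2\subseteq C_1\subseteq\mathbb{F}_2^n$ with $\dim C_1-\dim C_2=1$, the CSS code of $C_2\subseteq C_1$ is the $n$-qubit stabilizer code, encoding one logical qubit, whose $X$-stabilizers are the $X^{c}$, $c\in C_2$, and whose $Z$-stabilizers are the $Z^{c}$, $c\in C_1^\perp$ (Euclidean dual). Logical $X$- and $Z$-operators correspond to elements of $C_1\setminus C_2$ and $C_2^\perp\setminus C_1^\perp$. With $u\in C_1\setminus C_2$, the logical basis states are, up to normalization, $|0\rangle=\sum_{c\in C_2}|c\rangle$ and $|1\rangle=\sum_{c\in C_2}|c+u\rangle$. Local geometry in the first $n_2$ positions: let $Q_1$ be the CSS code of $C_2\subseteq C_1\subseteq\mathbb{F}_2^{n_1}$, $Q_2$ the CSS code of $C_2'\subseteq C_1'\subseteq\mathbb{F}_2^{n_2}$, and $A$ the set of the first $n_2$ qubits of $Q_1$. The condition is: (puncturing rule) restricting the $X$-stabilizers and $X$-logical operators of $Q_1$ to $A$ gives the $X$-stabilizers and $X$-logical operators of $Q_2$, i.e. $C_2|_A=C_2'$ and $C_1|_A=C_1'$; and (shortening rule) the $Z$-stabilizers and $Z$-logical operators of $Q_1$ supported inside $A$ give the $Z$-stabilizers and $Z$-logical operators of $Q_2$, i.e. $\{z\in C_1^\perp:\mathrm{supp}\,z\subseteq A\}$ and $\{z\in C_2^\perp:\mathrm{supp}\,z\subseteq A\}$, restricted to $A$, are $C_1'^\perp$ and $C_2'^\perp$. $R_Z(\theta)=\mathrm{diag}(1,e^{i\theta})$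 (up to global phase), and $|R_Z(\theta)\rangle=R_Z(\theta)|+\rangle=\frac{1}{\sqrt2}(|0\rangle+e^{i\theta}|1\rangle)$; states are considered up to global phase. A unitary on the data qubits realizes a logical gate if it preserves the code space and acts on it as that gate. *)

(* Defs.v *)
From HB Require Import structures.
From mathcomp Require Import all_boot all_order all_algebra.
From mathcomp Require Import reals trigo.
From mathcomp Require Import complex.

Set Implicit Arguments.
Unset Strict Implicit.
Unset Printing Implicit Defensive.

Import Order.TTheory GRing.Theory Num.Theory.

Local Open Scope ring_scope.
Local Open Scope complex_scope.

Notation word n := 'rV['F_2]_n.

Section BinaryCodes.

Definition dotw n (x y : word n) : 'F_2 := \sum_i x 0 i * y 0 i.

Definition dual n (C : {vspace word n}) : {set word n} :=
  [set z | [forall (c | c \in C), dotw c z == 0]].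

Record css n := Css {
  cssC1 : {vspace word n};
  cssC2 : {vspace word n};
  css_sub : (cssC2 <= cssC1)%VS;
  css_dim : \dim cssC1 = (\dim cssC2).+1 }.

Definition logicalX n (Q : css n) : {set word n} :=
  [set x | (x \in cssC1 Q) && (x \notin cssC2 Q)].

Definition logicalZ n (Q : css n) : {set word n} :=
  dual (cssC2 Q) :\: dual (cssC1 Q).

Section LocalGeometry.
Variables (n1 n2 : nat) (lt_n : (n2 < n1)%N).

Definition pos (i : 'I_n2) : 'I_n1 := widen_ord (ltnW lt_n) i.

Definition restrict (x : word n1) : word n2 := \row_i x 0 (pos i).

Definition supp_first (x : word n1) : bool :=
  [forall i : 'I_n1, (x 0 i != 0) ==> (i < n2)%N].

Definition puncture (C : {vspace word n1}) : {set word n2} :=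
  [set restrict x | x in C].

Definition shorten (D : {set word n1}) : {set word n2} :=
  [set restrict z | z in D & supp_first z].

Definition local_geometry (Q1 : css n1) (Q2 : css n2) : Prop :=
  [/\ puncture (cssC2 Q1) =i cssC2 Q2,
      puncture (cssC1 Q1) =i cssC1 Q2,
      shorten (dual (cssC1 Q1)) = dual (cssC1 Q2)
    & shorten (dual (cssC2 Q1)) = dual (cssC2 Q2)].

End LocalGeometry.
End BinaryCodes.

(* The state space with computational basis I; an n-qubit register is
   I = word n, a single qubit is I = 'F_2, and a bipartite system is a
   product of index types. *)
Notation state R I := {ffun I -> R[i]}.

Section QuantumStates.
Variable R : realType.

Definition ket (I : finType) (x : I) : state R I := [ffun y => (y == x)%:R].

(* The linear map sending |x> to F x for every basis label x. *)
Definition linext (I J : finType) (F : I -> state R J) (psi : state R I) :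
  state R J := \sum_x psi x *: F x.

Definition inner (I : finType) (phi psi : state R I) : R[i] :=
  \sum_x (phi x)^* * psi x.

Definition normalize (I : finType) (psi : state R I) : state R I :=
  (sqrtC (inner psi psi))^-1 *: psi.

Definition unitary (I : finType) (U : state R I -> state R I) : Prop :=
  [/\ linear U, bijective U
    & forall phi psi, inner (U phi) (U psi) = inner phi psi].

Definition tensor (I J : finType) (phi : state R I) (psi : state R J) :
  state R (I * J)%type := [ffun xy => phi xy.1 * psi xy.2].

Definition tensor_op (I J : finType) (U : state R I -> state R I)
    (V : state R J -> state R J) :
  state R (I * J)%type -> state R (I * J)%type :=
  linext (fun xy => tensor (U (ket xy.1)) (V (ket xy.2))).

Definition opX n (c : word n) : state R (word n) -> state R (word n) :=
  linext (fun x => ket (x + c)).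

Definition opZ n (c : word n) : state R (word n) -> state R (word n) :=
  linext (fun x => (-1) ^+ (dotw c x) *: ket x).

Definition expi (theta : R) : R[i] := cos theta +i* sin theta.

Definition gateRZ (theta : R) : state R 'F_2 -> state R 'F_2 :=
  linext (fun a => (if a == 0 then 1 else expi theta) *: ket a).

Definition gateCNOT : state R ('F_2 * 'F_2)%type -> state R ('F_2 * 'F_2)%type :=
  linext (fun ab : 'F_2 * 'F_2 => ket (ab.1, ab.1 + ab.2)).

Definition plus : state R 'F_2 := normalize (ket 0 + ket 1).

Definition stateRZ (theta : R) : state R 'F_2 := gateRZ theta plus.

Section TransversalCNOT.
Variables (n1 n2 : nat) (lt_n : (n2 < n1)%N).

Definition CNOT_at (i : 'I_n2) :
  state R (word n1 * word n2)%type -> state R (word n1 * word n2)%type :=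
  linext (fun xy : word n1 * word n2 => ket (xy.1, xy.2 + xy.1 0 (pos lt_n i) *: delta_mx 0 i)).

(* The CNOT_at i act on pairwise disjoint pairs of qubits, so their tensor
   product is their composite, in any order. *)
Definition CNOTbar :
  state R (word n1 * word n2)%type -> state R (word n1 * word n2)%type :=
  \big[(fun f g => f \o g)/id]_(i < n2) CNOT_at i.

End TransversalCNOT.

Section CodeStates.
Variables (n : nat) (Q : css n).

Definition in_code (psi : state R (word n)) : Prop :=
  (forall c, c \in cssC2 Q -> opX c psi = psi) /\
  (forall c, c \in dual (cssC1 Q) -> opZ c psi = psi).

(* For u in C1 \ C2, the normalized logical basis states |0> and |1>. *)
Definition ketL (u : word n) (a : 'F_2) : state R (word n) :=
  normalize (\sum_(c | c \in cssC2 Q) ket (c + a *: u)).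

End CodeStates.

Section JointCode.
Variables (n1 n2 : nat) (Q1 : css n1) (Q2 : css n2).

(* The stabilizer code on n1 + n2 qubits whose stabilizer group is generated
   by those of Q1 and Q2, acting on their respective registers. *)
Definition in_code2 (Psi : state R (word n1 * word n2)%type) : Prop :=
  [/\ forall c, c \in cssC2 Q1 -> tensor_op (opX c) id Psi = Psi,
      forall c, c \in dual (cssC1 Q1) -> tensor_op (opZ c) id Psi = Psi,
      forall c, c \in cssC2 Q2 -> tensor_op id (opX c) Psi = Psi
    & forall c, c \in dual (cssC1 Q2) -> tensor_op id (opZ c) Psi = Psi].

Definition ketL2 (u1 : word n1) (u2 : word n2) (ab : 'F_2 * 'F_2) :
  state R (word n1 * word n2)%type := tensor (ketL Q1 u1 ab.1) (ketL Q2 u2 ab.2).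

End JointCode.

(* The unitary U preserves the code space [code] and acts on it as the logical
   gate G, with respect to the logical basis states [b k], k : K. *)
Definition realizes (K I : finType) (code : state R I -> Prop)
    (b : K -> state R I) (U : state R I -> state R I)
    (G : state R K -> state R K) : Prop :=
  [/\ unitary U, forall psi, code psi -> code (U psi)
    & forall phi, U (linext b phi) = linext b (G phi)].

(* Projective measurement of an observable M with M^2 = 1: the outcome is
   (-1)^s and M = P_false - P_true. *)
Definition outcome_proj (I : finType) (M : state R I -> state R I) (s : bool)
    (psi : state R I) : state R I := 2^-1 *: (psi + (-1) ^+ s *: M psi).

Definition outcome_prob (I : finType) (M : state R I -> state R I) (s : bool)
    (psi : state R I) : R[i] :=
  inner (outcome_proj M s psi) (outcome_proj M s psi).

Definition post_measurement (I : finType) (M : state R I -> state R I)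
    (s : bool) (psi : state R I) : state R I :=
  normalize (outcome_proj M s psi).

Section Circuit.
Variables (n1 n2 : nat) (lt_n : (n2 < n1)%N) (Q1 : css n1) (Q2 : css n2).
Variables (u1 : word n1) (u2 : word n2) (O : state R (word n1) -> state R (word n1)).
Variables (xL : word n1) (zL : word n2).

Definition circuit_premeasure : state R (word n1 * word n2)%type :=
  CNOTbar lt_n (tensor_op O id
    (tensor (linext (ketL Q1 u1) plus) (ketL Q2 u2 0))).

Definition circuit_prob (s : bool) : R[i] :=
  outcome_prob (tensor_op (opX xL) id) s circuit_premeasure.

Definition circuit_output (s : bool) : state R (word n1 * word n2)%type :=
  let psi := post_measurement (tensor_op (opX xL) id) s circuit_premeasure in
  if s then tensor_op id (opZ zL) psi else psi.

End Circuit.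

(* The second register is in the pure state psi; the global phase of psi is
   absorbed in phi. *)
Definition outputs_on_snd (I J : finType) (Psi : state R (I * J)%type)
    (psi : state R J) : Prop :=
  exists phi : state R I, inner phi phi = 1 /\ Psi = tensor phi psi.

End QuantumStates.

(* Main.v *)
(** In the computational basis the transversal CNOT sends |x, y> to
    |x, y + r x>, where r is restriction to the first n2 positions.  By the
    puncturing rule r maps C2 into C2' and C1 \ C2 into C1' \ C2', so the coset
    of C2 labelled a shifts the cosets of C2' by a; this is the logical CNOT.
    The stabilizers are preserved because r C2 lies in C2' and, by the
    shortening rule, every word of the dual of C1' is the restriction of a word
    of the dual of C1 supported in the first n2 positions.

    In the circuit, CNOT produces sum_a f a |a>|a>, where f holds the amplitudes
    of |R_Z(theta)>.  Since X_L exchanges |0> and |1>, projecting on the outcome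
    (-1)^s factors this state as (|0> + (-1)^s |1>) times
    sum_a (-1)^(s a) f a |a>, and Z_L removes the sign. *)

From HB Require Import structures.
Require Import Defs.
From mathcomp Require Import all_boot all_order all_algebra.
From mathcomp Require Import reals trigo.
From mathcomp Require Import complex.
From mathcomp Require Import ring.
Import Order.TTheory GRing.Theory Num.Theory.
Local Open Scope ring_scope.

(* Unqualified, [restrict] denotes a later MathComp constant. *)
Local Notation restrict := Defs.restrict.

Lemma sum_F2 {V : nmodType} (f : 'F_2 -> V) : \sum_a f a = f 0 + f 1.
Proof.
by rewrite big_ord_recl big_ord1; congr (f _ + f _); apply/val_inj.
Qed.

Lemma F2_cases (a : 'F_2) : a = 0 \/ a = 1.
Proof.
by case: a => [[|[|//]] lt_a]; [left | right]; apply/val_inj.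
Qed.

(** * Binary words, dual codes and the two cosets of C2 in C1 *)

Section Words.
Context {n : nat}.
Implicit Types x y z : word n.

Lemma dotwDr x y z : dotw x (y + z) = dotw x y + dotw x z.
Proof. by rewrite -big_split; apply: eq_bigr => i _; rewrite mxE mulrDr. Qed.

Lemma dotwNr x y : dotw x (- y) = - dotw x y.
Proof. by rewrite -sumrN; apply: eq_bigr => i _; rewrite mxE mulrN. Qed.

Lemma dotwZr x a y : dotw x (a *: y) = a * dotw x y.
Proof. by rewrite mulr_sumr; apply: eq_bigr => i _; rewrite mxE mulrCA. Qed.

Lemma dualP (C : {vspace word n}) z :
  reflect (forall c, c \in C -> dotw c z = 0) (z \in dual C).
Proof.
rewrite inE; apply: (iffP forall_inP) => H c Cc; last by rewrite H.
exact/eqP/H.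
Qed.

Lemma dotwC x y : dotw x y = dotw y x.
Proof. by apply: eq_bigr => i _; rewrite mulrC. Qed.

Lemma logicalXP {Q : css n} {u} :
  u \in logicalX Q -> u \in cssC1 Q /\ u \notin cssC2 Q.
Proof. by rewrite inE => /andP. Qed.

(** Since [u] lies outside C2, the space C2 + <u> has dimension dim C2 + 1 = dim C1 and so fills
    C1. *)
Lemma cssC1_coset {Q : css n} {u} x : u \in logicalX Q -> x \in cssC1 Q ->
  exists a : 'F_2, x - a *: u \in cssC2 Q.
Proof.
move=> /logicalXP[C1u C2u] C1x.
have sub1 : (cssC2 Q + <[u]> <= cssC1 Q)%VS by rewrite subv_add css_sub.
have dim1 : \dim (cssC2 Q + <[u]>) = \dim (cssC1 Q).
  rewrite dimv_disjoint_sum ?css_dim ?dim_vline; last first.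
    apply/eqP; rewrite -subv0; apply/subvP => v /memv_capP[C2v /vlineP[k vE]].
    have [k0|k1] := F2_cases k; first by rewrite vE k0 scale0r mem0v.
    by move: C2u; rewrite -[u]scale1r -k1 -vE C2v.
  by rewrite (_ : u != 0) ?addn1 //; apply: contraNneq C2u => ->; exact: mem0v.
have /eqP C1E : (cssC2 Q + <[u]>)%VS == cssC1 Q.
  by rewrite eqEdim sub1 dim1 leqnn.
move: C1x; rewrite -C1E => /memv_addP[v C2v [w /vlineP[a ->] ->]].
by exists a; rewrite addrK.
Qed.

Lemma logicalX_shift {Q : css n} {u} x : u \in logicalX Q ->
  x \in logicalX Q -> x - u \in cssC2 Q.
Proof.
move=> Hu /logicalXP[C1x C2x]; have [a] := cssC1_coset x Hu C1x.
by have [->|->] := F2_cases a; rewrite ?scale1r // scale0r subr0 (negPf C2x).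
Qed.

(** If the product were 0, [z], already orthogonal to C2, would be orthogonal to C2 + <u> = C1 and
    so lie in the dual of C1. *)
Lemma dotw_logical {Q : css n} {u z} : u \in logicalX Q -> z \in logicalZ Q ->
  dotw z u = 1.
Proof.
move=> Hu; rewrite inE => /andP[nC1z /dualP C2z].
have [zu0|//] := F2_cases (dotw z u).
case/dualP: nC1z => c /(cssC1_coset c Hu)[a C2c].
rewrite -[c](subrK (a *: u)) dotwC dotwDr dotwZr zu0 mulr0 addr0 dotwC.
exact: C2z.
Qed.

End Words.

(** * Restriction to the first [n2] positions and the local geometry *)

Section Restriction.
Context {n1 n2 : nat} {lt_n : (n2 < n1)%N}.

Lemma restrictD (x y : word n1) :
  restrict lt_n (x + y) = restrict lt_n x + restrict lt_n y.
Proof. by apply/rowP => i; rewrite !mxE. Qed.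

Lemma restrictN (x : word n1) : restrict lt_n (- x) = - restrict lt_n x.
Proof. by apply/rowP => i; rewrite !mxE. Qed.

Lemma restrictZ a (x : word n1) :
  restrict lt_n (a *: x) = a *: restrict lt_n x.
Proof. by apply/rowP => i; rewrite !mxE. Qed.

Lemma dotw_restrict (z x : word n1) : supp_first n2 z ->
  dotw (restrict lt_n z) (restrict lt_n x) = dotw z x.
Proof.
move=> /forallP zA; rewrite [RHS](bigID (fun i : 'I_n1 => (i < n2)%N)) /=.
rewrite (big_ord_narrow (ltnW lt_n)) [X in _ + X]big1 ?addr0 => [|i].
  by apply: eq_bigr => i _; rewrite !mxE.
by move/negPf=> ni; have:= zA i; rewrite ni implybF negbK => /eqP->;
  rewrite mul0r.
Qed.

Section Geometry.
Context {Q1 : css n1} {Q2 : css n2} (geom : local_geometry lt_n Q1 Q2).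

Lemma restrict_C2 c : c \in cssC2 Q1 -> restrict lt_n c \in cssC2 Q2.
Proof. by case: geom => <- _ _ _; apply: imset_f. Qed.

Lemma restrict_C1 c : c \in cssC1 Q1 -> restrict lt_n c \in cssC1 Q2.
Proof. by case: geom => _ <- _ _; apply: imset_f. Qed.

(* With r the restriction: if r u were in C2', then r C1 = r C2 + <r u> would
   lie in C2' instead of being all of C1'. *)
Lemma restrict_logicalX u : u \in logicalX Q1 ->
  restrict lt_n u \in logicalX Q2.
Proof.
move=> Hu; have [C1u _] := logicalXP Hu; rewrite inE restrict_C1 //=.
apply/negP => C2u; have := css_dim Q2.
suff /dimvS : (cssC1 Q2 <= cssC2 Q2)%VS.
  by move=> le dE; move: le; rewrite dE ltnn.
apply/subvP => y; case: geom => _ <- _ _.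
case/imsetP=> x /(cssC1_coset x Hu)[a C2x] ->.
rewrite -[x](subrK (a *: u)) restrictD restrictZ rpredD ?rpredZ //.
exact: restrict_C2.
Qed.

(** The shortening rule provides [z] supported in the first positions, so pairing with it sees only
    the restriction. This turns a Z-check on the target into one on the control. *)
Lemma dual_C1_lift c : c \in dual (cssC1 Q2) -> exists2 z,
  z \in dual (cssC1 Q1) & forall x, dotw c (restrict lt_n x) = dotw z x.
Proof.
case: geom => _ _ <- _ /imsetP[z]; rewrite inE => /andP[C1z zA] ->.
by exists z => // x; rewrite dotw_restrict.
Qed.

End Geometry.
End Restriction.

(** * States and linear maps given on computational basis vectors *)

Section States.
Context {R : realType}.

Lemma scale_stateE {I : finType} k (psi : state R I) x :
  (k *: psi) x = k * psi x.
Proof. exact: ffunE. Qed.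

Lemma add_stateE {I : finType} (phi psi : state R I) x :
  (phi + psi) x = phi x + psi x.
Proof. exact: ffunE. Qed.

Section Linext.
Context {I J : finType}.
Implicit Types (F : I -> state R J) (phi psi : state R I).

Lemma linextE F psi z : linext F psi z = \sum_x psi x * F x z.
Proof. by rewrite sum_ffunE; apply: eq_bigr => x _; rewrite ffunE. Qed.

Lemma eq_linext F G : F =1 G -> linext F =1 linext G.
Proof. by move=> FG psi; apply: eq_bigr => x _; rewrite FG. Qed.

Lemma linextP F k phi psi :
  linext F (k *: phi + psi) = k *: linext F phi + linext F psi.
Proof.
rewrite scaler_sumr -big_split; apply: eq_bigr => x _.
by rewrite !ffunE scalerDl scalerA.
Qed.

Lemma linextZ F k psi : linext F (k *: psi) = k *: linext F psi.
Proof.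
by rewrite scaler_sumr; apply: eq_bigr => x _; rewrite scale_stateE scalerA.
Qed.

Lemma linext_ket F x : linext F (ket R x) = F x.
Proof.
rewrite /linext (bigD1 x) //= ffunE eqxx scale1r big1 ?addr0 // => y.
by rewrite ffunE => /negPf->; rewrite scale0r.
Qed.

(** A state is the sum of the kets weighted by its amplitudes. An abstract operator such as [O]
    thereby becomes an explicit sum. *)
Lemma linear_linext {U : state R I -> state R J} : linear U ->
  U =1 linext (fun x => U (ket R x)).
Proof.
move=> linU psi.
(* Linearity is given only as a proposition; packing it as a structure makes [linear_sum] and
   [linearZ] applicable. *)
pose U' := GRing.isLinear.Build _ _ _ _ U linU.
pose f : {linear state R I -> state R J} := HB.pack U U'.
have psiE : psi = \sum_x psi x *: ket R x.
  apply/ffunP => y; rewrite sum_ffunE (bigD1 y) //= [X in X + _]scale_stateE.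
  rewrite ffunE eqxx mulr1 big1 ?addr0 // => x.
  by rewrite [LHS]scale_stateE ffunE eq_sym => /negPf->; rewrite mulr0.
rewrite {1}psiE -[U]/(f : _ -> _) linear_sum.
by apply: eq_bigr => x _; rewrite linearZ.
Qed.

End Linext.

Lemma linext_comp {I J K : finType} (U : state R J -> state R K)
    (F : I -> state R J) psi : linear U ->
  U (linext F psi) = linext (U \o F) psi.
Proof.
move=> linU; rewrite (linear_linext linU).
apply/ffunP => z; rewrite !linextE.
under eq_bigr do rewrite linextE mulr_suml.
rewrite exchange_big; apply: eq_bigr => x _ /=.
rewrite [U (F x)](linear_linext linU) linextE mulr_sumr.
by apply: eq_bigr => y _; rewrite mulrA.
Qed.

Section Diagonal.
Context {I : finType}.
Implicit Types (psi : state R I).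

Lemma linext_perm (f g : I -> I) psi y : cancel f g -> cancel g f ->
  linext (fun x => ket R (f x)) psi y = psi (g y).
Proof.
move=> fK gK; rewrite linextE (bigD1 (g y)) //= ffunE gK eqxx mulr1.
rewrite big1 ?addr0 // => x xNgy; rewrite ffunE eq_sym (can2_eq fK gK).
by rewrite (negPf xNgy) mulr0.
Qed.

Lemma linext_diag (d : I -> R[i]) psi y :
  linext (fun x => d x *: ket R x) psi y = d y * psi y.
Proof.
rewrite linextE (bigD1 y) //= [X in _ * X + _]scale_stateE.
rewrite ffunE eqxx mulr1 mulrC big1 ?addr0 // => x.
by rewrite [X in _ * X]scale_stateE ffunE eq_sym => /negPf->; rewrite !mulr0.
Qed.

End Diagonal.

(** * Inner products and normalization *)

Section Inner.
Context {I J : finType}.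
Implicit Types (phi psi : state R I).

Lemma inner_ge0 psi : 0 <= inner psi psi.
Proof. by apply: sumr_ge0 => x _; rewrite mulrC -normCK exprn_ge0. Qed.

Lemma innerZ k psi : inner (k *: psi) (k *: psi) = `|k| ^+ 2 * inner psi psi.
Proof.
rewrite mulr_sumr; apply: eq_bigr => x _; rewrite scale_stateE rmorphM normCK.
by rewrite mulrACA [_ * k]mulrC.
Qed.

Lemma inner_tensor phi (psi : state R J) :
  inner (tensor phi psi) (tensor phi psi) = inner phi phi * inner psi psi.
Proof.
rewrite /inner big_distrlr pair_big; apply: eq_bigr => -[x y] _ /=.
by rewrite !ffunE rmorphM mulrACA.
Qed.

Lemma inner_normalize psi : inner psi psi != 0 ->
  inner (normalize psi) (normalize psi) = 1.
Proof.
move=> psi_n0; rewrite innerZ normfV exprVn.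
by rewrite ger0_norm ?sqrtC_ge0 ?inner_ge0 // sqrtCK mulVf.
Qed.

(** With a unit second factor the norm is that of [phi], so renormalizing after the measurement
    affects the first register only. *)
Lemma normalize_tensor phi (psi : state R J) : inner psi psi = 1 ->
  normalize (tensor phi psi) = tensor (normalize phi) psi.
Proof.
move=> psi1; apply/ffunP => z; rewrite /normalize inner_tensor psi1 mulr1.
by rewrite !(scale_stateE, ffunE) mulrA.
Qed.

(** Parseval's identity: encoding along an orthonormal family is an isometry. *)
Lemma inner_linext (F : J -> state R I) (psi : state R J) :
  (forall a b, inner (F a) (F b) = (a == b)%:R) ->
  inner (linext F psi) (linext F psi) = inner psi psi.
Proof.
move=> orthF; rewrite /inner.
under eq_bigr do rewrite linextE rmorph_sum big_distrlr /=.
rewrite exchange_big; apply: eq_bigr => a _ /=; rewrite exchange_big /=.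
have E b : \sum_x (psi a * F a x)^* * (psi b * F b x)
    = (psi a)^* * psi b * (a == b)%:R.
  rewrite -orthF mulr_sumr; apply: eq_bigr => x _.
  by rewrite rmorphM mulrACA.
under eq_bigr do rewrite E.
rewrite (bigD1 a) //= eqxx mulr1 big1 ?addr0 // => b.
by rewrite eq_sym => /negPf->; rewrite mulr0.
Qed.

End Inner.

(** * Pauli operators and operators on two registers *)

Section Paulis.
Context {n : nat}.
Implicit Types (psi : state R (word n)).

Lemma opX_linear (c : word n) : linear (@opX R n c).
Proof. exact: linextP. Qed.

Lemma opZ_linear (c : word n) : linear (@opZ R n c).
Proof. exact: linextP. Qed.

Lemma opX_ket (c x : word n) : opX c (ket R x) = ket R (x + c).
Proof. exact: linext_ket. Qed.

Lemma opZ_ket (c x : word n) :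
  opZ c (ket R x) = (-1) ^+ (dotw c x) *: ket R x.
Proof. exact: linext_ket. Qed.

End Paulis.

Section TensorOp.
Context {n1 n2 : nat}.
Implicit Types (Psi : state R (word n1 * word n2)%type).

Lemma tensor_ket {I J : finType} (x : I) (y : J) :
  tensor (ket R x) (ket R y) = ket R (x, y).
Proof.
by apply/ffunP => -[a b]; rewrite !ffunE -natrM mulnb /= xpair_eqE.
Qed.

Lemma tensorE {I J : finType} (phi : state R I) (psi : state R J) x y :
  tensor phi psi (x, y) = phi x * psi y.
Proof. exact: ffunE. Qed.

Lemma tensor_linext {I J K : finType} (F : K -> state R I) phi
    (psi : state R J) :
  tensor (linext F phi) psi = linext (fun k => tensor (F k) psi) phi.
Proof.
apply/ffunP => -[x y]; rewrite tensorE !linextE mulr_suml.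
by apply: eq_bigr => k _; rewrite tensorE mulrA.
Qed.

Lemma tensorZ {I J : finType} k (phi : state R I) (psi : state R J) :
  tensor phi (k *: psi) = tensor (k *: phi) psi.
Proof. by apply/ffunP => z; rewrite !(scale_stateE, ffunE) mulrCA mulrA. Qed.

Lemma tensor_op_linear {I J : finType} (U : state R I -> state R I)
    (V : state R J -> state R J) : linear (tensor_op U V).
Proof. exact: linextP. Qed.

(** [tensor_op] is fixed by its values on kets; linearity of both factors carries the formula to all
    product states. *)
Lemma tensor_op_tensor {I J : finType} (U : state R I -> state R I)
    (V : state R J -> state R J) phi psi : linear U -> linear V ->
  tensor_op U V (tensor phi psi) = tensor (U phi) (V psi).
Proof.
move=> linU linV; apply/ffunP => -[x y]; rewrite linextE ffunE /=.
rewrite (linear_linext linU) (linear_linext linV) !linextE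
  big_distrlr pair_big.
by apply: eq_bigr => -[a b] _; rewrite !ffunE mulrACA.
Qed.

Lemma tensor_opX1 c Psi x y :
  tensor_op (opX c) id Psi (x, y) = Psi (x - c, y).
Proof.
rewrite /tensor_op (@eq_linext _ _ _ (fun xy => ket R (xy.1 + c, xy.2))).
  rewrite (@linext_perm _ _ (fun xy => (xy.1 - c, xy.2))) //.
    by case=> a b; rewrite /= addrK.
  by case=> a b; rewrite /= subrK.
by case=> a b; rewrite /= opX_ket tensor_ket.
Qed.

Lemma tensor_op1X c Psi x y :
  tensor_op id (opX c) Psi (x, y) = Psi (x, y - c).
Proof.
rewrite /tensor_op (@eq_linext _ _ _ (fun xy => ket R (xy.1, xy.2 + c))).
  rewrite (@linext_perm _ _ (fun xy => (xy.1, xy.2 - c))) //.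
    by case=> a b; rewrite /= addrK.
  by case=> a b; rewrite /= subrK.
by case=> a b; rewrite /= opX_ket tensor_ket.
Qed.

Lemma tensor_opZ1 c Psi x y :
  tensor_op (opZ c) id Psi (x, y) = (-1) ^+ (dotw c x) * Psi (x, y).
Proof.
rewrite /tensor_op.
rewrite (@eq_linext _ _ _ (fun xy => (-1) ^+ (dotw c xy.1) *: ket R xy)).
  by rewrite (linext_diag (fun xy => (-1) ^+ (dotw c xy.1))).
case=> a b; rewrite /= opZ_ket -tensor_ket.
by apply/ffunP => z; rewrite !(scale_stateE, ffunE) mulrA.
Qed.

Lemma tensor_op1Z c Psi x y :
  tensor_op id (opZ c) Psi (x, y) = (-1) ^+ (dotw c y) * Psi (x, y).
Proof.
rewrite /tensor_op.
rewrite (@eq_linext _ _ _ (fun xy => (-1) ^+ (dotw c xy.2) *: ket R xy)).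
  by rewrite (linext_diag (fun xy => (-1) ^+ (dotw c xy.2))).
case=> a b; rewrite /= opZ_ket -tensor_ket.
by apply/ffunP => z; rewrite !(scale_stateE, ffunE) mulrCA.
Qed.

End TensorOp.

(** * Logical basis states and the logical Pauli operators on them *)

Section CodeBasis.
Context {n : nat} {Q : css n} {u : word n} (Hu : u \in logicalX Q).

(** If the labels differed, subtracting the two memberships would put [u] in C2. *)
Lemma coset_inj (x : word n) (a b : 'F_2) :
  x - a *: u \in cssC2 Q -> x - b *: u \in cssC2 Q -> a = b.
Proof.
move=> xa xb; apply/eqP; rewrite -subr_eq0; have [_ C2u] := logicalXP Hu.
have [->//|ab1] := F2_cases (a - b).
case/negP: C2u; rewrite -[u]scale1r -ab1 scalerBl.
have -> : a *: u - b *: u = (x - b *: u) - (x - a *: u).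
  by rewrite opprB [RHS]addrC addrA subrK.
exact: rpredB.
Qed.

(** The squared norm of an unnormalized logical basis state. *)
Definition code_weight : R[i] := #|[set c : word n | c \in cssC2 Q]|%:R.

Lemma code_weight_gt0 : 0 < code_weight.
Proof.
rewrite ltr0n; apply/card_gt0P; exists 0.
by rewrite inE mem0v.
Qed.

Lemma sum_coset (a : 'F_2) (x : word n) :
  (\sum_(c | c \in cssC2 Q) ket R (c + a *: u)) x
    = (x - a *: u \in cssC2 Q)%:R.
Proof.
rewrite sum_ffunE (eq_bigr (fun c => (x - a *: u == c)%:R)) => [|c _].
  case: (boolP (_ \in _)) => Cx.
    rewrite (bigD1 _ Cx) /= eqxx big1 ?addr0 // => c /andP[_].
    by rewrite eq_sym => /negPf->.
  by rewrite big1 // => c Cc; case: eqP Cx => // ->; rewrite Cc.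
by rewrite ffunE subr_eq.
Qed.

Lemma inner_coset (a b : 'F_2) :
  inner (\sum_(c | c \in cssC2 Q) ket R (c + a *: u))
        (\sum_(c | c \in cssC2 Q) ket R (c + b *: u))
    = (a == b)%:R * code_weight.
Proof.
rewrite /inner; under eq_bigr do rewrite !sum_coset conjC_nat -natrM mulnb.
case: eqP => [<-|ab]; last first.
  rewrite mul0r big1 // => x _; case: andP => // -[xa xb].
  by case: ab; apply: coset_inj xa xb.
(* Translation by [a *: u] turns the count of the coset into a count of C2. *)
rewrite mul1r (reindex_inj (addIr (a *: u))) /=.
under eq_bigr do rewrite addrK andbb.
rewrite -natr_sum; congr (_%:R); rewrite -sum1_card [RHS]big_mkcond /=.
by apply: eq_bigr => x _; rewrite inE; case: ifP.
Qed.

Lemma ketLE (a : 'F_2) (x : word n) :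
  ketL R Q u a x = (sqrtC code_weight)^-1 * (x - a *: u \in cssC2 Q)%:R.
Proof. by rewrite scale_stateE sum_coset inner_coset eqxx mul1r. Qed.

Lemma inner_ketL (a b : 'F_2) :
  inner (ketL R Q u a) (ketL R Q u b) = (a == b)%:R.
Proof.
have w0 := code_weight_gt0.
transitivity (`|(sqrtC code_weight)^-1| ^+ 2 * ((a == b)%:R * code_weight)).
  rewrite -inner_coset /inner mulr_sumr; apply: eq_bigr => x _.
  rewrite [X in _ * X = _]ketLE [X in X^* * _ = _]ketLE.
  rewrite !sum_coset normCK rmorphM.
  by rewrite mulrACA [_^* * _^-1]mulrC.
rewrite normfV exprVn ger0_norm ?sqrtC_ge0 ?(ltW w0) // sqrtCK.
by rewrite mulrCA mulVf ?mulr1 // gt_eqF.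
Qed.

Lemma opX_ketL (xL : word n) (a : 'F_2) : xL \in logicalX Q ->
  opX xL (ketL R Q u a) = ketL R Q u (a + 1).
Proof.
move=> HxL; apply/ffunP => x.
rewrite (@linext_perm _ _ (fun x => x - xL)); [|exact: addrK|exact: subrK].
(* The correction [xL - u] lies in C2, since both words represent the nonzero class of C1 modulo
   C2. *)
have E : x - (a + 1) *: u = (x - xL - a *: u) + (xL - u).
  by rewrite scalerDl scale1r opprD !addrA [_ - a *: u + xL]addrAC subrK.
rewrite [LHS]ketLE [RHS]ketLE E; congr (_ * (nat_of_bool _)%:R).
by apply/esym/rpredDr/logicalX_shift.
Qed.

(** As [zL] is orthogonal to C2 and pairs to 1 with [u], its product with every word of the coset of
    [a *: u] is [a]. *)
Lemma opZ_ketL (zL : word n) (a : 'F_2) : zL \in logicalZ Q ->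
  opZ zL (ketL R Q u a) = (-1) ^+ a *: ketL R Q u a.
Proof.
move=> HzL; apply/ffunP => x.
rewrite (linext_diag (fun x => (-1) ^+ (dotw zL x))) [RHS]scale_stateE ketLE.
case: (boolP (_ \in _)) => C2x; last by rewrite !mulr0.
congr ((-1) ^+ _ * _); rewrite -[x](subrK (a *: u)) dotwDr dotwZr.
move: HzL (dotw_logical Hu HzL) => /setDP[/dualP C2z _] ->.
by rewrite dotwC C2z // add0r mulr1.
Qed.

End CodeBasis.

(** * The transversal CNOT on amplitudes, code space and logical states *)

Section TransversalCNOT.
Context {n1 n2 : nat} {lt_n : (n2 < n1)%N}.
Implicit Types (Psi Phi : state R (word n1 * word n2)%type).

Lemma CNOT_atE i Psi x y : CNOT_at lt_n i Psi (x, y)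
  = Psi (x, y - x 0 (pos lt_n i) *: delta_mx 0 i).
Proof.
pose f := fun xy : word n1 * word n2 =>
  (xy.1, xy.2 - xy.1 0 (pos lt_n i) *: delta_mx 0 i).
rewrite /CNOT_at (@linext_perm _ _ f) // => -[a b]; rewrite /f /=.
  by rewrite addrK.
by rewrite subrK.
Qed.

Lemma CNOTbarE Psi x y :
  CNOTbar lt_n Psi (x, y) = Psi (x, y - restrict lt_n x).
Proof.
have -> : restrict lt_n x = \sum_i x 0 (pos lt_n i) *: delta_mx 0 i.
  by rewrite {1}[restrict _ _]row_sum_delta; apply: eq_bigr => i _; rewrite mxE.
rewrite /CNOTbar.
(* Each factor fixes [x], so the shifts of [y] accumulate; the induction needs an arbitrary index
   list and a general [y]. *)
elim: (index_enum _) y => [|i r IHr] y; first by rewrite !big_nil subr0.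
by rewrite !big_cons /= CNOT_atE IHr opprD addrA.
Qed.

Lemma CNOTbar_linear : linear (@CNOTbar R n1 n2 lt_n).
Proof.
move=> k Phi Psi; apply/ffunP => -[x y].
by rewrite !(CNOTbarE, ffunE).
Qed.

Lemma CNOTbar_unitary : unitary (@CNOTbar R n1 n2 lt_n).
Proof.
split; first exact: CNOTbar_linear.
  exists (fun Psi => [ffun xy => Psi (xy.1, xy.2 + restrict lt_n xy.1)]) => Psi.
    by apply/ffunP => -[x y]; rewrite !ffunE CNOTbarE addrK.
  by apply/ffunP => -[x y]; rewrite CNOTbarE ffunE subrK.
move=> Phi Psi.
pose f := fun xy : word n1 * word n2 => (xy.1, xy.2 - restrict lt_n xy.1).
pose g := fun xy : word n1 * word n2 => (xy.1, xy.2 + restrict lt_n xy.1).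
have fK : cancel f g by case=> x y; rewrite /f /g /= subrK.
rewrite [RHS](reindex_inj (can_inj fK)) /=.
by apply: eq_bigr => -[x y] _; rewrite !CNOTbarE.
Qed.

Context {Q1 : css n1} {Q2 : css n2} (geom : local_geometry lt_n Q1 Q2).

Lemma CNOTbar_in_code2 Psi :
  in_code2 Q1 Q2 Psi -> in_code2 Q1 Q2 (CNOTbar lt_n Psi).
Proof.
case=> HX1 HZ1 HX2 HZ2.
have X1 c x y : c \in cssC2 Q1 -> Psi (x - c, y) = Psi (x, y).
  by move=> Cc; rewrite -tensor_opX1 HX1.
have X2 c x y : c \in cssC2 Q2 -> Psi (x, y - c) = Psi (x, y).
  by move=> Cc; rewrite -tensor_op1X HX2.
have Z1 c x y : c \in dual (cssC1 Q1) ->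
    (-1) ^+ (dotw c x) * Psi (x, y) = Psi (x, y).
  by move=> Cc; rewrite -tensor_opZ1 HZ1.
have Z2 c x y : c \in dual (cssC1 Q2) ->
    (-1) ^+ (dotw c y) * Psi (x, y) = Psi (x, y).
  by move=> Cc; rewrite -tensor_op1Z HZ2.
split=> c Cc; apply/ffunP => -[x y].
(* An X-stabilizer of the control propagates to its restriction on the target, which is an
   X-stabilizer of [Q2]. *)
- rewrite tensor_opX1 !CNOTbarE restrictD restrictN opprD addrA X1 //.
  by rewrite X2 // rpredN; apply: (restrict_C2 geom).
- by rewrite tensor_opZ1 CNOTbarE Z1.
- by rewrite tensor_op1X !CNOTbarE addrAC X2.
(* A Z-stabilizer [c] of the target propagates to its lift [z] on the control, and [z] already fixes
   the state. *)
rewrite tensor_op1Z CNOTbarE; have [z Cz zE] := dual_C1_lift geom _ Cc.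
rewrite -{1}(Z1 z _ _ Cz) -[RHS](Z2 c _ _ Cc) mulrA; congr (_ * _).
rewrite dotwDr dotwNr zE.
(* The exponents are elements of F2 read as naturals, which does not respect addition, so the sign
   identity is checked case by case. *)
by have [->|->] := F2_cases (dotw c y); have [->|->] := F2_cases (dotw z x);
  rewrite ?expr0 ?mul1r ?mulr1 ?mulN1r ?opprK.
Qed.

Context {u1 : word n1} (Hu1 : u1 \in logicalX Q1).
Context {u2 : word n2} (Hu2 : u2 \in logicalX Q2).

Lemma CNOTbar_ketL2 (a b : 'F_2) :
  CNOTbar lt_n (ketL2 R Q1 Q2 u1 u2 (a, b)) = ketL2 R Q1 Q2 u1 u2 (a, a + b).
Proof.
apply/ffunP => -[x y]; rewrite CNOTbarE [LHS]tensorE [RHS]tensorE.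
rewrite [X in X * _ = _](ketLE Hu1) [X in _ = X * _](ketLE Hu1).
rewrite [X in _ * X = _](ketLE Hu2) [X in _ = _ * X](ketLE Hu2).
case: (boolP (_ \in _)) => C2x; last by rewrite mulr0 !mul0r.
congr (_ * (_ * (nat_of_bool _)%:R)).
(* The subtracted bracket lies in C2': its first term by puncturing, its second because the
   restriction of [u1] and [u2] are both logical X words of [Q2]. *)
rewrite scalerDl [y - _](_ : _ = (y - (a *: u2 + b *: u2)) 
  - (restrict lt_n (x - a *: u1) + a *: (restrict lt_n u1 - u2)) + b *: u2).
  rewrite addrK; apply: rpredBr.
  rewrite rpredD ?rpredZ ?(restrict_C2 geom) //.
  exact/(logicalX_shift _ Hu2)/(restrict_logicalX geom).
rewrite restrictD restrictN restrictZ scalerBr addrA subrK.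
by rewrite opprB opprD !addrA [_ - b *: u2 + _]addrAC subrK [RHS]addrAC subrK.
Qed.

Lemma CNOTbar_gate phi : CNOTbar lt_n (linext (ketL2 R Q1 Q2 u1 u2) phi)
  = linext (ketL2 R Q1 Q2 u1 u2) (gateCNOT phi).
Proof.
rewrite (linext_comp _ _ _ CNOTbar_linear) (linext_comp _ _ _ (linextP _)).
by apply: eq_linext => -[a b]; rewrite /= CNOTbar_ketL2 linext_ket.
Qed.

Lemma CNOTbar_tensor_ketL0 phi :
  CNOTbar lt_n (tensor (linext (ketL R Q1 u1) phi) (ketL R Q2 u2 0))
  = linext (fun a => ketL2 R Q1 Q2 u1 u2 (a, a)) phi.
Proof.
rewrite tensor_linext (linext_comp _ _ _ CNOTbar_linear).
by apply: eq_linext => a; rewrite /= [CNOTbar _ _]CNOTbar_ketL2 addr0.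
Qed.

(** Beside target label [a] the control becomes |a> + (-1)^s |a+1>, which is (-1)^(s a) times |0> +
    (-1)^s |1>; only the sign depends on [a], and it moves to the target. *)
Lemma outcome_proj_logicalX xL s phi : xL \in logicalX Q1 ->
  outcome_proj (tensor_op (opX xL) id) s
    (linext (fun a => ketL2 R Q1 Q2 u1 u2 (a, a)) phi)
  = tensor (2^-1 *: (ketL R Q1 u1 0 + (-1) ^+ s *: ketL R Q1 u1 1))
      (linext (ketL R Q2 u2) [ffun a : 'F_2 => (-1) ^+ (s * a)%N * phi a]).
Proof.
move=> HxL; have XE : tensor_op (opX xL) id
    (linext (fun a => ketL2 R Q1 Q2 u1 u2 (a, a)) phi)
    = linext (fun a => ketL2 R Q1 Q2 u1 u2 (a + 1, a)) phi.
  rewrite (linext_comp _ _ _ (tensor_op_linear _ _)); apply: eq_linext => a.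
  rewrite /= /ketL2 tensor_op_tensor ?(opX_ketL Hu1) //; exact: opX_linear.
rewrite /outcome_proj XE.
rewrite /ketL2 /=; move: (ketL R Q1 u1) (ketL R Q2 u2) => k1 k2.
apply/ffunP => -[x y]; rewrite [RHS]tensorE [LHS]scale_stateE.
rewrite [X in _ = X * _]scale_stateE !add_stateE.
rewrite [X in _ * (_ + X) = _]scale_stateE.
rewrite [X in _ = _ * (_ + X) * _]scale_stateE.
rewrite !linextE !sum_F2 !tensorE !ffunE.
have -> : 1 + 1 = 0 :> 'F_2 by apply/val_inj.
rewrite add0r muln0 muln1 expr0 mul1r.
by case: s => /=; rewrite ?expr0 ?expr1; ring.
Qed.

Lemma opZ_correction zL (s : bool) (phi : state R 'F_2) : zL \in logicalZ Q2 ->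
  (if s then opZ zL else id)
    (linext (ketL R Q2 u2) [ffun a : 'F_2 => (-1) ^+ (s * a)%N * phi a])
  = linext (ketL R Q2 u2) phi.
Proof.
move=> HzL; case: s => /=; last first.
  by rewrite /linext; apply: eq_bigr => a _; rewrite ffunE mul0n expr0 mul1r.
rewrite (linext_comp _ _ _ (opZ_linear _)) /linext; apply: eq_bigr => a _.
rewrite ffunE /= (opZ_ketL Hu2) // scalerA mul1n mulrC mulrA -exprD.
by rewrite addnn -mul2n exprM sqrrN !expr1n mul1r.
Qed.

End TransversalCNOT.

(** * The norm of the state |R_Z(theta)> *)

Lemma norm_expi theta : `|expi theta : R[i]| = 1.
Proof. by rewrite normc_def /= cos2Dsin2 sqrtr1. Qed.

Lemma inner_stateRZ theta :
  inner (stateRZ theta) (stateRZ theta : state R 'F_2) = 1.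
Proof.
have plus1 : inner (plus R) (plus R) = 1.
  apply: inner_normalize; rewrite /inner sum_F2 !ffunE /=.
  by rewrite !addr0 !add0r conjC1 mulr1 (pnatr_eq0 _ 2).
(* The gate is diagonal with entries of modulus 1, so each squared amplitude is unchanged. *)
rewrite -plus1; apply: eq_bigr => a _.
rewrite (linext_diag (fun a => if a == 0 then 1 else expi theta)) rmorphM.
rewrite mulrACA [X in X * _]mulrC -normCK; case: eqP => _.
  by rewrite normr1 expr1n mul1r.
by rewrite norm_expi expr1n mul1r.
Qed.

End States.

(** * The logical CNOT gate and the output of the circuit *)

Theorem theoremV1 (R : realType) (n1 n2 : nat) (lt_n : (n2 < n1)%N)
    (Q1 : css n1) (Q2 : css n2) (geom : local_geometry lt_n Q1 Q2)
    (u1 : word n1) (Hu1 : u1 \in logicalX Q1)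
    (u2 : word n2) (Hu2 : u2 \in logicalX Q2) :
  realizes (in_code2 Q1 Q2) (ketL2 R Q1 Q2 u1 u2)
    (CNOTbar lt_n) (@gateCNOT R)
  /\
  (forall (theta : R) (O : state R (word n1) -> state R (word n1)),
     (exists c : R[i], `|c| = 1 /\
        realizes (in_code Q1) (ketL R Q1 u1) O
          (fun phi => c *: gateRZ theta phi)) ->
     forall (xL : word n1) (zL : word n2),
       xL \in logicalX Q1 -> zL \in logicalZ Q2 ->
       forall s : bool,
         circuit_prob lt_n Q1 Q2 u1 u2 O xL s != 0 ->
         outputs_on_snd (circuit_output lt_n Q1 Q2 u1 u2 O xL zL s)
           (linext (ketL R Q2 u2) (stateRZ theta))).
Proof.
split.
  split; [exact: CNOTbar_unitary|exact: CNOTbar_in_code2 geom|].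
  exact: CNOTbar_gate geom _ Hu1 _ Hu2.
move=> theta O [c [c1 [[linO _ _] _ OE]]] xL zL HxL HzL s.
rewrite /circuit_prob /circuit_output /outcome_prob /post_measurement.
have -> : circuit_premeasure lt_n Q1 Q2 u1 u2 O
    = linext (fun a => ketL2 R Q1 Q2 u1 u2 (a, a)) (c *: stateRZ theta).
  rewrite /circuit_premeasure tensor_op_tensor // OE.
  exact: CNOTbar_tensor_ketL0 geom _ Hu1 _ Hu2 _.
rewrite (outcome_proj_logicalX Hu1) //.
set chi := _ *: (_ + _); set phi_s := finfun _.
(* The signs have modulus 1 and the logical basis is orthonormal, so the target factor is a unit
   vector and the outcome probability is the squared norm of [chi]. *)
have psi1 :
    inner (linext (ketL R Q2 u2) phi_s) (linext (ketL R Q2 u2) phi_s) = 1.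
  rewrite (inner_linext _ _ (inner_ketL Hu2)).
  transitivity (inner (c *: stateRZ theta) (c *: stateRZ theta)).
    apply: eq_bigr => a _; rewrite ffunE rmorphM mulrACA.
    by rewrite [X in X * _]mulrC -normCK normrX normrN1 !expr1n mul1r.
  by rewrite innerZ c1 inner_stateRZ expr1n mul1r.
rewrite inner_tensor psi1 mulr1 normalize_tensor // => chi_n0.
(* The global phase [c] left by [O] is assigned to the control register, so that the target state is
   exact. *)
exists (c *: normalize chi); split.
  by rewrite innerZ c1 expr1n mul1r inner_normalize.
have psiE : c *: linext (ketL R Q2 u2) (stateRZ theta)
    = (if s then opZ zL else id) (linext (ketL R Q2 u2) phi_s).
  rewrite -(linextZ _ c); exact: esym (opZ_correction Hu2 _ _ _ HzL).
rewrite -[RHS](tensorZ c (normalize chi)) psiE.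
by case: (s) => //; rewrite tensor_op_tensor //; exact: opZ_linear.
Qed.
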